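(* The statement ''for every real $\nu\ge0$, the function $u\mapsto\sqrt u\,I_\nu(u)$ is strictly log-concave on $(0,\infty)$'' is false. Strict log-concavity fails at $\nu=0$, $u=10$, and it also fails on a nonempty open set of parameters $(\nu,u)$ with $\nu>0$, $u>0$.
   Context: $I_\nu$ is the modified Bessel function of the first kind of order $\nu$: for $u>0$, $I_\nu(u)=\sum_{k\ge0}\frac{(u/2)^{2k+\nu}}{k!\,\Gamma(k+\nu+1)}$. Strict log-concavity of $u\mapsto \sqrt u\,I_\nu(u)$ on $(0,\infty)$ means strict concavity of $g_\nu(u)=\log(\sqrt u\,I_\nu(u))$ there. Pointwise, strict log-concavity at $(\nu,u)$ means $g_\nu''(u)<0$, where derivatives are taken in $u$; it ''fails at $(\nu,u)$'' if this inequality does not hold. *)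

(* Defs.v *)
(* Real analysis over the classical reals of Stdlib, with Coquelicot. *)
From Stdlib Require Import Reals Factorial.
From Coquelicot Require Import Coquelicot.
Open Scope R_scope.

(* Euler's integral, improper at both ends.  It converges for x > 0; only
   arguments x >= 1 occur below. *)
Definition Gamma (x : R) : R :=
  RInt_gen (fun t => Rpower t (x - 1) * exp (- t))
           (at_right 0) (Rbar_locally p_infty).

(* Meaningful for u > 0: Rpower is the real power of a positive base. *)
Definition BesselI (nu u : R) : R :=
  Series (fun k : nat =>
    Rpower (u / 2) (2 * INR k + nu) / (INR (fact k) * Gamma (INR k + nu + 1))).

Definition besselG (nu u : R) : R := ln (sqrt u * BesselI nu u).

Definition strictly_concave_on (D : R -> Prop) (f : R -> R) : Prop :=
  forall x y t : R, D x -> D y -> x <> y -> 0 < t < 1 ->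
    t * f x + (1 - t) * f y < f (t * x + (1 - t) * y).

Definition strictly_log_concave_sqrt_Bessel (nu : R) : Prop :=
  strictly_concave_on (fun u => 0 < u) (besselG nu).

(* [Derive] is a total operator with an arbitrary value where the derivative
   does not exist, so the existence of f''(x) is recorded separately. *)
Definition twice_derivable_at (f : R -> R) (x : R) : Prop :=
  locally x (fun y => ex_derive f y) /\ ex_derive (Derive f) x.

Definition strict_log_concavity_at (nu u : R) : Prop :=
  Derive_n (besselG nu) 2 u < 0.

(* The inequality g_nu''(u) < 0 does not hold, for a g_nu''(u) that exists. *)
Definition strict_log_concavity_fails_at (nu u : R) : Prop :=
  twice_derivable_at (besselG nu) u /\ ~ strict_log_concavity_at nu u.

(* Main.v *)
Require Import Defs.
From Stdlib Require Import Reals Lra Factorial.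
From Coquelicot Require Import Coquelicot.
Open Scope R_scope.

(** Write [I_nu u = c u^nu F(u^2 / 4)], with [F = 0F1(; nu + 1; .)] and a
    constant [c > 0].  Then [g = const + (nu + 1/2) ln u + ln F(u^2 / 4)], and
    with [z = u^2 / 4] the second derivative is
    [g''(u) = H(z) / (u^2 F(z)^2)], where [H] ([curvature]) is a quadratic
    form in [F] and [F'] because [z F'' + (nu + 1) F' = F].

    The point is that [H] obeys a first order equation with a signed right
    hand side ([curvature_euler]):
    [2 z H' + (2 nu - 1) H = (1/2 - 2 nu^2) F^2].
    In the coefficients [H_n] of [z^n] it reads
    [(2 n + 2 nu - 1) H_n = (1/2 - 2 nu^2) (F^2)_n], so for [0 <= nu < 1/2]
    the constant term [- (nu + 1/2)] is the only negative coefficient of [H],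
    and [H(z) >= (1 - 2 nu) / (nu + 1) z - (nu + 1/2)].  The lemma
    [curvature_lower] derives this bound from the equation by a comparison
    argument at the singular point 0 ([euler_inequality_nonneg]).

    Consequently [g'' > 0] whenever [0 <= nu < 1/4] and [u > 4].  This region
    contains [(0, 10)] and the open set [0 < nu < 1/4], [u > 4]; and [g] is
    convex on [(4, oo)] for [nu = 0], against strict concavity.

    The Gamma function enters only through [Gamma (x + 1) = x Gamma x] and
    [Gamma x > 0] for [x >= 1], which are proved from Euler's integral. *)

(** * Monotone functions and their limits *)

Lemma exp_nondecreasing (a b : R) : a <= b -> exp a <= exp b.
Proof. intros [H | ->]; [left; now apply exp_increasing | right; easy]. Qed.

Lemma nondecreasing_of_derivative (f df : R -> R) (a b : R) :
  a <= b ->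
  (forall x, a <= x <= b -> is_derive f x (df x)) ->
  (forall x, a <= x <= b -> 0 <= df x) ->
  f a <= f b.
Proof.
  intros Hab Hd Hp.
  destruct (MVT_gen f a b df) as [c [Hc E]];
    rewrite ?Rmin_left, ?Rmax_right in * by lra.
  - intros x Hx. apply Hd; lra.
  - intros x Hx. apply derivable_continuous_pt. exists (df x).
    apply is_derive_Reals. now apply Hd.
  - assert (0 <= df c * (b - a)) by (apply Rmult_le_pos; [apply Hp|]; lra). lra.
Qed.

Lemma nondecreasing_bounded_lim_infty (f : R -> R) (M : R) :
  (forall s t, 1 <= s <= t -> f s <= f t) ->
  (forall t, 1 <= t -> f t <= M) ->
  exists L, filterlim f (Rbar_locally p_infty) (locally L) /\
    forall t, 1 <= t -> f t <= L.
Proof.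
  intros Hm Hb.
  destruct (completeness (fun y => exists t, 1 <= t /\ y = f t)) as [L [HL1 HL2]].
  - exists M. intros y [t [Ht ->]]. now apply Hb.
  - exists (f 1), 1. split; [lra | reflexivity].
  - assert (HL : forall t, 1 <= t -> f t <= L).
    { intros t Ht. apply HL1. now exists t. }
    exists L. split; [| exact HL].
    apply filterlim_locally. intros eps.
    assert (Hs : exists s, 1 <= s /\ L - eps < f s).
    { apply Classical_Prop.NNPP. intros N.
      assert (L <= L - eps).
      { apply HL2. intros y [t [Ht ->]].
        destruct (Rle_dec (f t) (L - eps)) as [|n]; [easy|].
        exfalso. apply N. exists t. lra. }
      destruct eps as [e He]; simpl in *; lra. }
    destruct Hs as [s [Hs1 Hs2]].
    exists s. intros t Ht.
    assert (f s <= f t) by (apply Hm; lra).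
    assert (f t <= L) by (apply HL; lra).
    apply Rabs_def1; unfold minus, plus, opp; simpl; lra.
Qed.

(** The substitution [t -> 1 / t] reduces this to the limit at infinity. *)
Lemma nondecreasing_bounded_lim_0 (f : R -> R) (m : R) :
  (forall s t, 0 < s <= t -> t <= 1 -> f s <= f t) ->
  (forall t, 0 < t <= 1 -> m <= f t) ->
  exists l, filterlim f (at_right 0) (locally l) /\
    forall t, 0 < t <= 1 -> l <= f t.
Proof.
  intros Hm Hb.
  assert (Hinv : forall t, 1 <= t -> 0 < / t <= 1).
  { intros t Ht. split; [apply Rinv_0_lt_compat; lra|].
    rewrite <- Rinv_1. apply Rinv_le_contravar; lra. }
  destruct (nondecreasing_bounded_lim_infty (fun t => - f (/ t)) (- m))
    as [L [HL HL']].
  - intros s t Hst. apply Ropp_le_contravar, Hm.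
    + split; [apply Hinv; lra | apply Rinv_le_contravar; lra].
    + apply Hinv; lra.
  - intros t Ht. apply Ropp_le_contravar, Hb, Hinv, Ht.
  - exists (- L). split.
    + apply filterlim_ext_loc with (fun t => opp (- f (/ / t))).
      * exists (mkposreal 1 Rlt_0_1). intros t _ Ht.
        rewrite Rinv_inv. unfold opp; simpl. ring.
      * eapply filterlim_comp; [| apply (filterlim_opp L)].
        exact (filterlim_comp _ _ _ Rinv _ _ _ _ filterlim_Rinv_0_right HL).
    + intros t Ht. specialize (HL' (/ t)). rewrite Rinv_inv in HL'.
      enough (- f t <= L) by lra. apply HL'.
      rewrite <- Rinv_1. apply Rinv_le_contravar; lra.
Qed.

(** * Improper integrals over the half line *)

Lemma is_RInt_gen_half_line (F f : R -> R) (la lb : R) :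
  (forall t, 0 < t -> is_derive F t (f t)) ->
  (forall t, 0 < t -> continuous f t) ->
  filterlim F (at_right 0) (locally la) ->
  filterlim F (Rbar_locally p_infty) (locally lb) ->
  is_RInt_gen f (at_right 0) (Rbar_locally p_infty) (lb - la).
Proof.
  intros Hd Hc Ha Hb.
  assert (Hpos : forall P : R -> Prop, (forall t, 0 < t -> P t) ->
    filter_prod (at_right 0) (Rbar_locally p_infty)
      (fun ab => forall x, Rmin (fst ab) (snd ab) <= x <= Rmax (fst ab) (snd ab) -> P x)).
  { intros P HP. apply Filter_prod with (fun a => 0 < a) (fun b => 0 < b).
    - exists (mkposreal 1 Rlt_0_1). easy.
    - exists 0. easy.
    - intros a b Ha' Hb' x [Hx _]. apply HP. simpl in Hx.
      revert Hx. unfold Rmin. destruct Rle_dec; lra. }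
  apply is_RInt_gen_ext with (Derive F).
  - eapply filter_imp; [| apply (Hpos (fun t => Derive F t = f t))].
    + intros ab H x Hx. apply H; lra.
    + intros t Ht. now apply is_derive_unique, Hd.
  - apply is_RInt_gen_Derive; try assumption.
    + apply (Hpos (fun t => ex_derive F t)). intros t Ht. exists (f t). now apply Hd.
    + apply (Hpos (fun t => continuous (Derive F) t)). intros t Ht.
      apply continuous_ext_loc with f.
      * exists (mkposreal t Ht). intros y Hy. symmetry.
        apply is_derive_unique, Hd.
        apply Rabs_def2 in Hy. unfold minus, plus, opp in Hy; simpl in Hy. lra.
      * now apply Hc.
Qed.

(** * Convergence, positivity and recurrence of the Gamma integral *)

Lemma Rpower_exp_decay (y : R) :
  0 <= y -> exists C, 0 < C /\
    forall t, 1 <= t -> Rpower t y * exp (- t) <= C * exp (- t / 2).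
Proof.
  intros Hy. exists (exp (y * ln (2 * (y + 1)))). split; [apply exp_pos|].
  intros t Ht. unfold Rpower. rewrite <- !exp_plus.
  (* The inequality [ln s <= s] at this [s] absorbs [y * ln t] into [t / 2]. *)
  set (s := t / (2 * (y + 1))).
  assert (Hs : 0 < s) by (apply Rdiv_lt_0_compat; lra).
  assert (Hln : ln t = ln (2 * (y + 1)) + ln s).
  { rewrite <- ln_mult by lra. f_equal. unfold s. field. lra. }
  assert (Hls : ln s <= s).
  { pose proof (exp_ineq1_le (ln s)). rewrite exp_ln in H by lra. lra. }
  assert (Hys : y * ln s <= t / 2).
  { apply Rle_trans with (y * s); [apply Rmult_le_compat_l; lra|].
    replace (t / 2) with ((y + 1) * s) by (unfold s; field; lra).
    apply Rmult_le_compat_r; lra. }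
  assert (Hle : y * ln t + - t <= y * ln (2 * (y + 1)) + - t / 2).
  { rewrite Hln. lra. }
  now apply exp_nondecreasing.
Qed.

Lemma exp_half_lim_infty (C : R) :
  0 < C -> filterlim (fun t => C * exp (- t / 2)) (Rbar_locally p_infty) (locally 0).
Proof.
  intros HC. apply filterlim_locally. intros [eps He].
  exists (2 * ln (C / eps)). intros t Ht.
  assert (Hlt : exp (- t / 2) < eps / C).
  { replace (eps / C) with (exp (- ln (C / eps))).
    - apply exp_increasing. lra.
    - rewrite exp_Ropp, exp_ln by (now apply Rdiv_lt_0_compat). field. lra. }
  assert (H0 : 0 < C * exp (- t / 2)) by (apply Rmult_lt_0_compat; [easy | apply exp_pos]).
  assert (H1 : C * exp (- t / 2) < eps).
  { replace eps with (C * (eps / C)) by (field; lra). now apply Rmult_lt_compat_l. }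
  apply Rabs_def1; unfold minus, plus, opp; simpl; lra.
Qed.

Lemma Rpower_exp_lim_infty (y : R) :
  0 <= y ->
  filterlim (fun t => Rpower t y * exp (- t)) (Rbar_locally p_infty) (locally 0).
Proof.
  intros Hy. destruct (Rpower_exp_decay y Hy) as [C [HC Hb]].
  apply (filterlim_le_le (fun _ => 0) _ (fun t => C * exp (- t / 2)) (Finite 0)).
  - exists 1. intros t Ht. split; [| apply Hb; lra].
    apply Rlt_le, Rmult_lt_0_compat; apply exp_pos.
  - apply filterlim_const.
  - now apply exp_half_lim_infty.
Qed.

Lemma Rpower_exp_lim_0 (y : R) :
  1 <= y -> filterlim (fun t => Rpower t y * exp (- t)) (at_right 0) (locally 0).
Proof.
  intros Hy.
  apply (filterlim_le_le (fun _ => 0) _ (fun t => t) (Finite 0)).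
  - exists (mkposreal 1 Rlt_0_1). intros t Ht Ht0.
    apply Rabs_def2 in Ht. unfold minus, plus, opp in Ht; simpl in Ht.
    split; [apply Rlt_le, Rmult_lt_0_compat; apply exp_pos|].
    assert (Hln : ln t <= 0) by (rewrite <- ln_1; apply ln_le; lra).
    unfold Rpower. rewrite <- exp_plus. rewrite <- (exp_ln t) at 3 by lra.
    assert (Hle : y * ln t + - t <= ln t) by nra.
    now apply exp_nondecreasing.
  - apply filterlim_const.
  - intros P HP. apply filter_le_within. exact HP.
Qed.

Definition gamma_integrand (x t : R) : R := Rpower t (x - 1) * exp (- t).

Lemma gamma_integrand_pos (x t : R) : 0 < gamma_integrand x t.
Proof. apply Rmult_lt_0_compat; apply exp_pos. Qed.

Lemma gamma_integrand_continuous (x t : R) : 0 < t -> continuous (gamma_integrand x) t.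
Proof.
  intros Ht. apply (ex_derive_continuous (K := R_AbsRing) (V := R_NormedModule)).
  unfold gamma_integrand, Rpower.
  now auto_derive.
Qed.

(** The primitive based at 1 is increasing.  Near infinity it is bounded
    because the integrand is at most [C exp (- t / 2)], near 0 because the
    integrand is at most 1; so it has limits at both ends, and their
    difference is positive. *)
Lemma Gamma_converges_pos (x : R) :
  1 <= x -> exists l, 0 < l /\
    is_RInt_gen (gamma_integrand x) (at_right 0) (Rbar_locally p_infty) l.
Proof.
  intros Hx.
  set (f := gamma_integrand x). set (P := fun t => RInt f 1 t).
  assert (Hd : forall t, 0 < t -> is_derive P t (f t)).
  { intros t Ht. apply (is_derive_RInt f P 1).
    - exists (mkposreal t Ht). intros y Hy.
      apply Rabs_def2 in Hy. unfold minus, plus, opp in Hy; simpl in Hy.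
      apply (RInt_correct f 1 y), (ex_RInt_continuous f). intros z Hz.
      apply gamma_integrand_continuous.
      revert Hz. unfold Rmin. destruct Rle_dec; lra.
    - now apply gamma_integrand_continuous. }
  assert (Hm : forall s t, 0 < s <= t -> P s <= P t).
  { intros s t Hst. apply nondecreasing_of_derivative with f; [lra | |].
    - intros z Hz. apply Hd. lra.
    - intros z Hz. apply Rlt_le, gamma_integrand_pos. }
  assert (P1 : P 1 = 0) by apply (RInt_point 1 f).
  destruct (Rpower_exp_decay (x - 1)) as [C [HC Hb]]; [lra|].
  (* [P t + 2 * C * exp (- t / 2)] is nonincreasing and its value at 1 is below [2 * C]. *)
  destruct (nondecreasing_bounded_lim_infty P (2 * C)) as [L [HL HL']].
  { intros s t Hst. apply Hm. lra. }
  { intros t Ht.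
    assert (H : - 2 * C * exp (- 1 / 2) - P 1 <= - 2 * C * exp (- t / 2) - P t).
    { apply (nondecreasing_of_derivative (fun t => - 2 * C * exp (- t / 2) - P t)
        (fun t => C * exp (- t / 2) - f t)); [lra | |].
      - intros z Hz. apply (is_derive_minus (K := R_AbsRing) (V := R_NormedModule)); [| apply Hd; lra].
        auto_derive; [easy | unfold Rdiv; field].
      - intros z Hz. cut (f z <= C * exp (- z / 2)); [lra|]. apply Hb. lra. }
    assert (0 < C * exp (- t / 2)) by (apply Rmult_lt_0_compat; [easy | apply exp_pos]).
    assert (exp (- 1 / 2) < 1) by (rewrite <- exp_0; apply exp_increasing; lra).
    nra. }
  destruct (nondecreasing_bounded_lim_0 P (- 1)) as [l [Hl Hl']].
  { intros s t Hst _. now apply Hm. }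
  { intros t Ht.
    assert (H : t - P t <= 1 - P 1).
    { apply (nondecreasing_of_derivative (fun t => t - P t) (fun t => 1 - f t)); [lra | |].
      - intros z Hz. apply (is_derive_minus (K := R_AbsRing) (V := R_NormedModule)).
        + apply (is_derive_id (K := R_AbsRing)).
        + apply Hd. lra.
      - intros z Hz. cut (f z <= 1); [lra|].
        unfold f, gamma_integrand, Rpower. rewrite <- exp_plus.
        assert (Hln : ln z <= 0) by (rewrite <- ln_1; apply ln_le; lra).
        apply Rle_trans with (exp 0); [apply exp_nondecreasing; nra | rewrite exp_0; lra]. }
    lra. }
  exists (L - l). split.
  - assert (H2 : P 1 < P 2).
    { apply (incr_function_le P 1 2 f); simpl; try lra.
      - intros z Hz _. apply Hd. lra.
      - intros z _ _. apply gamma_integrand_pos. }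
    assert (P 2 <= L) by (apply HL'; lra).
    assert (l <= P 1) by (apply Hl'; lra).
    lra.
  - apply is_RInt_gen_half_line with P; try assumption.
    intros t Ht. now apply gamma_integrand_continuous.
Qed.

Lemma Gamma_pos (x : R) : 1 <= x -> 0 < Gamma x.
Proof.
  intros Hx. destruct (Gamma_converges_pos x Hx) as [l [Hl H]].
  change (0 < RInt_gen (gamma_integrand x) (at_right 0) (Rbar_locally p_infty)).
  now rewrite (is_RInt_gen_unique _ _ H).
Qed.

(** Integration by parts: the boundary term [t^x exp (- t)] vanishes at 0 and
    at infinity. *)
Lemma Gamma_succ (x : R) : 1 <= x -> Gamma (x + 1) = x * Gamma x.
Proof.
  intros Hx.
  destruct (Gamma_converges_pos x Hx) as [l [_ Hl]].
  replace (Gamma x) with l by (symmetry; apply (is_RInt_gen_unique _ _ Hl)).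
  unfold Gamma. apply is_RInt_gen_unique.
  assert (Hbd : is_RInt_gen
    (fun t => x * gamma_integrand x t - gamma_integrand (x + 1) t)
    (at_right 0) (Rbar_locally p_infty) (0 - 0)).
  { apply is_RInt_gen_half_line with (fun t => Rpower t x * exp (- t)).
    - intros t Ht. unfold gamma_integrand.
      replace (x + 1 - 1) with x by ring.
      replace (Rpower t (x - 1)) with (Rpower t x / t).
      + unfold Rpower. auto_derive; [easy | field; lra].
      + unfold Rminus. rewrite Rpower_plus, Rpower_Ropp, Rpower_1 by easy. easy.
    - intros t Ht. unfold gamma_integrand, Rpower.
      apply (ex_derive_continuous (K := R_AbsRing) (V := R_NormedModule)). now auto_derive.
    - now apply Rpower_exp_lim_0.
    - apply Rpower_exp_lim_infty. lra. }
  pose proof (is_RInt_gen_minus _ _ _ _ (is_RInt_gen_scal _ x _ Hl) Hbd) as H.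
  replace (x * l) with (minus (scal x l) (0 - 0)).
  2: unfold minus, plus, opp, scal; simpl; unfold mult; simpl; ring.
  revert H. apply is_RInt_gen_ext. apply filter_forall. intros ab t _.
  unfold minus, plus, opp, scal, gamma_integrand; simpl; unfold mult; simpl. ring.
Qed.

(** * A differential inequality with a singular point *)

(** The inequality says that [E z / z^alpha] is nondecreasing.  As [E] is
    differentiable with [E 0 = 0], it is [O(z)], so this quotient is
    [O(z^(1 - alpha))] and tends to 0 at 0; it is therefore nonnegative. *)
Lemma euler_inequality_nonneg (alpha : R) (E dE : R -> R) :
  alpha < 1 -> E 0 = 0 ->
  (forall z, 0 <= z -> is_derive E z (dE z)) ->
  (forall z, 0 < z -> alpha * E z <= z * dE z) ->
  forall z, 0 < z -> 0 <= E z.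
Proof.
  intros Ha E0 Hd Hle z Hz.
  destruct (Rle_dec 0 (E z)) as [|Hneg]; [easy | exfalso].
  set (G := fun t => E t * exp (- alpha * ln t)).
  assert (HG : forall s, 0 < s <= z -> G s <= G z).
  { intros s Hs.
    apply nondecreasing_of_derivative with
      (fun t => (t * dE t - alpha * E t) * (exp (- alpha * ln t) / t)); [lra | |].
    - intros t Ht. assert (Hdt := Hd t). unfold G.
      auto_derive.
      + split; [exists (dE t); apply Hdt; lra | lra].
      + replace (Derive (fun x : R => E x) t) with (dE t)
          by (symmetry; apply is_derive_unique, Hdt; lra).
        field. lra.
    - intros t Ht. apply Rmult_le_pos.
      + specialize (Hle t). lra.
      + apply Rlt_le, Rdiv_lt_0_compat; [apply exp_pos | lra]. }
  set (c := - G z).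
  assert (Hc : 0 < c).
  { assert (0 < - E z * exp (- alpha * ln z))
      by (apply Rmult_lt_0_compat; [lra | apply exp_pos]).
    unfold c, G. lra. }
  assert (H0 : derivable_pt_lim E 0 (dE 0)).
  { apply is_derive_Reals, Hd. lra. }
  destruct (H0 1 Rlt_0_1) as [[d Hdp] Hd0]; simpl in Hd0.
  set (M := Rabs (dE 0) + 1).
  assert (HM : 0 < M) by (unfold M; pose proof (Rabs_pos (dE 0)); lra).
  (* For small s the bound E s >= - M s contradicts E s <= - c s^alpha. *)
  set (s := Rmin (Rmin z (d / 2)) (exp (ln (c / (2 * M)) / (1 - alpha)))).
  assert (Hs : 0 < s).
  { unfold s. repeat apply Rmin_glb_lt; try lra. apply exp_pos. }
  assert (Hsz : s <= z) by (eapply Rle_trans; apply Rmin_l).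
  assert (Hsd : s <= d / 2).
  { eapply Rle_trans; [apply Rmin_l | apply Rmin_r]. }
  assert (Hse : ln s <= ln (c / (2 * M)) / (1 - alpha)).
  { rewrite <- (ln_exp (ln (c / (2 * M)) / (1 - alpha))).
    apply ln_le; [easy | apply Rmin_r]. }
  assert (HEs : - (M * s) <= E s).
  { assert (H := Hd0 s). rewrite Rplus_0_l, E0, Rminus_0_r, (Rabs_pos_eq s) in H by lra.
    specialize (H ltac:(lra) ltac:(lra)).
    apply Rabs_def2 in H. destruct H as [_ H].
    assert (Hq : - M <= E s / s).
    { unfold M. pose proof (Rle_abs (- dE 0)). rewrite Rabs_Ropp in H1. lra. }
    replace (E s) with (E s / s * s) by (field; lra).
    nra. }
  assert (Hsmall : exp ((1 - alpha) * ln s) <= c / (2 * M)).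
  { rewrite <- (exp_ln (c / (2 * M))) by (apply Rdiv_lt_0_compat; lra).
    apply exp_nondecreasing.
    replace (ln (c / (2 * M))) with ((1 - alpha) * (ln (c / (2 * M)) / (1 - alpha)))
      by (field; lra).
    apply Rmult_le_compat_l; lra. }
  assert (HGs : - (M * exp ((1 - alpha) * ln s)) <= G s).
  { unfold G. replace ((1 - alpha) * ln s) with (ln s + - alpha * ln s) by ring.
    rewrite exp_plus, exp_ln by easy.
    pose proof (exp_pos (- alpha * ln s)). nra. }
  assert (M * exp ((1 - alpha) * ln s) <= c / 2).
  { replace (c / 2) with (M * (c / (2 * M))) by (field; lra).
    apply Rmult_le_compat_l; lra. }
  specialize (HG s (conj Hs Hsz)). unfold c in *. lra.
Qed.

(** * The hypergeometric series 0F1 *)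

Fixpoint pochhammer (x : R) (k : nat) : R :=
  match k with
  | O => 1
  | S k => pochhammer x k * (x + INR k)
  end.

Lemma pochhammer_pos (x : R) (k : nat) : 0 < x -> 0 < pochhammer x k.
Proof.
  intros Hx. induction k as [|k IH]; simpl; [lra|].
  apply Rmult_lt_0_compat; [easy|]. pose proof (pos_INR k). lra.
Qed.

Lemma Gamma_pochhammer (x : R) (k : nat) :
  1 <= x -> Gamma (INR k + x) = pochhammer x k * Gamma x.
Proof.
  intros Hx. induction k as [|k IH].
  - simpl. rewrite Rplus_0_l. ring.
  - rewrite S_INR. replace (INR k + 1 + x) with (INR k + x + 1) by ring.
    pose proof (pos_INR k).
    rewrite Gamma_succ, IH by lra. simpl. ring.
Qed.

Definition hyp0F1_coef (nu : R) (k : nat) : R := / (INR (fact k) * pochhammer (nu + 1) k).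

(** The function [0F1(; nu + 1; z)]; up to a constant factor,
    [I_nu u] is [u^nu] times its value at [z = u^2 / 4]. *)
Definition hyp0F1 (nu : R) : R -> R := PSeries (hyp0F1_coef nu).
Definition hyp0F1' (nu : R) : R -> R := PSeries (PS_derive (hyp0F1_coef nu)).
Definition hyp0F1'' (nu : R) : R -> R := PSeries (PS_derive (PS_derive (hyp0F1_coef nu))).

Lemma hyp0F1_coef_pos (nu : R) (k : nat) : 0 <= nu -> 0 < hyp0F1_coef nu k.
Proof.
  intros Hnu. apply Rinv_0_lt_compat, Rmult_lt_0_compat.
  - apply INR_fact_lt_0.
  - apply pochhammer_pos. lra.
Qed.

(** This recurrence carries both the infinite radius of convergence and the
    differential equation [hyp0F1_ode]. *)
Lemma hyp0F1_coef_succ (nu : R) (k : nat) :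
  0 <= nu -> INR (S k) * (nu + 1 + INR k) * hyp0F1_coef nu (S k) = hyp0F1_coef nu k.
Proof.
  intros Hnu. unfold hyp0F1_coef. rewrite fact_simpl, mult_INR. cbn [pochhammer].
  pose proof (INR_fact_neq_0 k). pose proof (pochhammer_pos (nu + 1) k).
  pose proof (pos_INR k). rewrite S_INR. field. repeat split; try lra.
Qed.

Lemma hyp0F1_coef_radius (nu : R) : 0 <= nu -> CV_radius (hyp0F1_coef nu) = p_infty.
Proof.
  intros Hnu. apply CV_radius_infinite_DAlembert.
  - intros n. pose proof (hyp0F1_coef_pos nu n Hnu). lra.
  - apply is_lim_seq_le_le with (fun _ => 0) (fun n => / INR (S n)).
    + intros n. split; [apply Rabs_pos|].
      pose proof (hyp0F1_coef_pos nu n Hnu) as H1. pose proof (hyp0F1_coef_pos nu (S n) Hnu) as H2.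
      pose proof (pos_INR n) as Hn. assert (HS : 0 < INR (S n)) by (rewrite S_INR; lra).
      rewrite Rabs_pos_eq by (apply Rlt_le, Rdiv_lt_0_compat; lra).
      rewrite <- (hyp0F1_coef_succ nu n Hnu).
      replace (hyp0F1_coef nu (S n) / (INR (S n) * (nu + 1 + INR n) * hyp0F1_coef nu (S n)))
        with (/ INR (S n) * / (nu + 1 + INR n)) by (field; lra).
      rewrite <- (Rmult_1_r (/ INR (S n))) at 2.
      apply Rmult_le_compat_l; [apply Rlt_le, Rinv_0_lt_compat; lra|].
      rewrite <- Rinv_1. apply Rinv_le_contravar; lra.
    + apply is_lim_seq_const.
    + apply (is_lim_seq_incr_1 (fun n => / INR n)).
      apply (is_lim_seq_inv INR p_infty); [apply is_lim_seq_INR | easy].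
Qed.

Lemma hyp0F1_derive (nu z : R) : 0 <= nu -> is_derive (hyp0F1 nu) z (hyp0F1' nu z).
Proof. intros Hnu. apply is_derive_PSeries. now rewrite hyp0F1_coef_radius. Qed.

Lemma hyp0F1'_derive (nu z : R) : 0 <= nu -> is_derive (hyp0F1' nu) z (hyp0F1'' nu z).
Proof.
  intros Hnu. apply is_derive_PSeries. now rewrite CV_radius_derive, hyp0F1_coef_radius.
Qed.

Lemma hyp0F1_ode (nu z : R) :
  0 <= nu -> z * hyp0F1'' nu z + (nu + 1) * hyp0F1' nu z = hyp0F1 nu z.
Proof.
  intros Hnu. unfold hyp0F1, hyp0F1', hyp0F1''.
  rewrite <- PSeries_incr_1, <- PSeries_scal, <- PSeries_plus.
  2: { apply CV_radius_inside.
       now rewrite CV_radius_incr_1, !CV_radius_derive, hyp0F1_coef_radius. }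
  2: { apply ex_pseries_scal; [apply Rmult_comm|].
       apply CV_radius_inside. now rewrite CV_radius_derive, hyp0F1_coef_radius. }
  apply PSeries_ext. intros n. rewrite <- (hyp0F1_coef_succ nu n Hnu).
  unfold PS_plus, PS_scal, PS_incr_1, PS_derive, plus, scal; simpl plus.
  unfold mult; cbn -[INR hyp0F1_coef].
  destruct n as [|n]; cbn -[INR hyp0F1_coef].
  - simpl INR. unfold zero; simpl. ring.
  - rewrite !S_INR. ring.
Qed.

Lemma hyp0F1_lower (nu z : R) : 0 <= nu -> 0 <= z -> 1 + z / (nu + 1) <= hyp0F1 nu z.
Proof.
  intros Hnu Hz. unfold hyp0F1.
  assert (Hr := hyp0F1_coef_radius nu Hnu).
  assert (Hr1 : CV_radius (PS_decr_1 (hyp0F1_coef nu)) = p_infty)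
    by now rewrite CV_radius_decr_1.
  assert (Hr2 : CV_radius (PS_decr_1 (PS_decr_1 (hyp0F1_coef nu))) = p_infty)
    by now rewrite CV_radius_decr_1.
  rewrite (PSeries_decr_1 (hyp0F1_coef nu)) by (apply CV_radius_inside; now rewrite Hr).
  rewrite (PSeries_decr_1 (PS_decr_1 _)) by (apply CV_radius_inside; now rewrite Hr1).
  set (b := PS_decr_1 (PS_decr_1 (hyp0F1_coef nu))) in *.
  assert (Hb : 0 <= PSeries b z).
  { rewrite <- (Rmult_0_l (Series (fun n => b n * z ^ n))), <- Series_scal_l.
    apply Series_le.
    - intros n. rewrite Rmult_0_l. split; [lra|].
      apply Rmult_le_pos; [left; apply (hyp0F1_coef_pos nu (S (S n)) Hnu) | now apply pow_le].
    - apply ex_pseries_R, CV_radius_inside. now rewrite Hr2. }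
  assert (Hc : hyp0F1_coef nu 0 = 1) by (unfold hyp0F1_coef; simpl; field).
  assert (Hc1 : PS_decr_1 (hyp0F1_coef nu) 0%nat = / (nu + 1)).
  { unfold PS_decr_1, hyp0F1_coef; simpl. field. lra. }
  rewrite Hc, Hc1. unfold Rdiv.
  pose proof (Rmult_le_pos z _ Hz (Rmult_le_pos z _ Hz Hb)). lra.
Qed.

Lemma hyp0F1_pos (nu z : R) : 0 <= nu -> 0 <= z -> 0 < hyp0F1 nu z.
Proof.
  intros Hnu Hz. apply Rlt_le_trans with (1 + z / (nu + 1)); [| now apply hyp0F1_lower].
  assert (0 <= z / (nu + 1)) by (apply Rdiv_le_0_compat; lra). lra.
Qed.

(** * Reduction of the Bessel function to 0F1 *)

(** [Gamma (k + nu + 1)] is a Pochhammer symbol times [Gamma (nu + 1)], so the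
    Gamma integral enters only through a positive factor independent of [u],
    which logarithmic derivatives do not see. *)
Lemma BesselI_eq (nu u : R) :
  0 <= nu -> 0 < u ->
  BesselI nu u = Rpower (u / 2) nu / Gamma (nu + 1) * hyp0F1 nu (u ^ 2 / 4).
Proof.
  intros Hnu Hu. unfold hyp0F1, PSeries. rewrite <- Series_scal_l.
  apply Series_ext. intros k.
  assert (HG : 0 < Gamma (nu + 1)) by (apply Gamma_pos; lra).
  rewrite Rplus_assoc, Gamma_pochhammer by lra.
  rewrite Rpower_plus, <- Rpower_mult.
  replace (Rpower (u / 2) 2) with (u ^ 2 / 4).
  2: { replace (Rpower (u / 2) 2) with (Rpower (u / 2) (INR 2)) by now simpl.
       rewrite Rpower_pow by lra. simpl. field. }
  rewrite Rpower_pow by nra.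
  unfold hyp0F1_coef. pose proof (INR_fact_neq_0 k). pose proof (pochhammer_pos (nu + 1) k).
  field. lra.
Qed.

(** * Positivity of the curvature *)

(** With [z = u^2 / 4] this is [u^2 g''(u) F(z)^2], where [F] is [hyp0F1 nu] and
    the second derivative of [F] has been eliminated by its differential
    equation. *)
Definition curvature (nu z : R) : R :=
  4 * z * hyp0F1 nu z ^ 2 - (4 * nu + 2) * z * hyp0F1 nu z * hyp0F1' nu z
  - 4 * z ^ 2 * hyp0F1' nu z ^ 2 - (nu + / 2) * hyp0F1 nu z ^ 2.

(** The derivative of [curvature], with the second derivative of [F]
    eliminated in the same way. *)
Definition curvature' (nu z : R) : R :=
  (2 - 4 * nu) * hyp0F1 nu z ^ 2 + (4 * nu - 2) * z * hyp0F1' nu z ^ 2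
  + (4 * nu ^ 2 - 1) * hyp0F1 nu z * hyp0F1' nu z.

Lemma curvature_derive (nu z : R) :
  0 <= nu -> is_derive (curvature nu) z (curvature' nu z).
Proof.
  intros Hnu. unfold curvature.
  assert (H1 := hyp0F1_derive nu z Hnu). assert (H2 := hyp0F1'_derive nu z Hnu).
  auto_derive.
  - repeat split; eexists; eassumption.
  - rewrite (is_derive_unique (hyp0F1 nu) _ _ H1 : Derive (fun x : R => hyp0F1 nu x) _ = _).
    rewrite (is_derive_unique (hyp0F1' nu) _ _ H2 : Derive (fun x : R => hyp0F1' nu x) _ = _).
    assert (Hode : z * hyp0F1'' nu z = hyp0F1 nu z - (nu + 1) * hyp0F1' nu z)
      by (rewrite <- (hyp0F1_ode nu z Hnu); ring).
    unfold curvature'.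
    match goal with |- ?L = ?R =>
      replace L with
        (4 * hyp0F1 nu z ^ 2 + 8 * z * hyp0F1 nu z * hyp0F1' nu z
         - (4 * nu + 2) * (hyp0F1 nu z * hyp0F1' nu z + z * hyp0F1' nu z ^ 2
                           + hyp0F1 nu z * (z * hyp0F1'' nu z))
         - 8 * z * hyp0F1' nu z ^ 2 - 8 * z * hyp0F1' nu z * (z * hyp0F1'' nu z)
         - (2 * nu + 1) * hyp0F1 nu z * hyp0F1' nu z) by (simpl; field) end.
    rewrite Hode. ring.
Qed.

(** Up to a constant multiple and a power of [u], this is the identity
    [W' = (1/2 - 2 nu^2) I_nu^2 / u^2] for the Wronskian type expression [W = y y'' - y'^2] of [y = sqrt u * I_nu u]: as
    [y'' = q y] with [q = 1 + (nu^2 - 1/4) / u^2], one has [W' = q' y^2].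
    The factor [1/2 - 2 nu^2] is positive for [0 <= nu < 1/2], which is what
    makes log-concavity fail. *)
Lemma curvature_euler (nu z : R) :
  2 * z * curvature' nu z + (2 * nu - 1) * curvature nu z
  = (/ 2 - 2 * nu ^ 2) * hyp0F1 nu z ^ 2.
Proof. unfold curvature, curvature'. field. Qed.

(** The bound is the sum of the first two Taylor terms of [curvature nu] at 0.
    After they are subtracted, [curvature_euler] and [F >= 1 + z / (nu + 1)]
    show that the remainder satisfies the hypothesis of
    [euler_inequality_nonneg] with [alpha = 1/2 - nu]. *)
Lemma curvature_lower (nu z : R) :
  0 <= nu < / 2 -> 0 < z ->
  (1 - 2 * nu) / (nu + 1) * z - (nu + / 2) <= curvature nu z.
Proof.
  intros Hnu Hz.
  set (b := (1 - 2 * nu) / (nu + 1)).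
  assert (H : 0 <= curvature nu z + (nu + / 2) - b * z); [| lra].
  apply (euler_inequality_nonneg (/ 2 - nu)
    (fun z => curvature nu z + (nu + / 2) - b * z) (fun z => curvature' nu z - b));
    try lra; clear z Hz.
  - unfold curvature.
    assert (Hc : hyp0F1 nu 0 = 1).
    { unfold hyp0F1. rewrite PSeries_0. unfold hyp0F1_coef. simpl. field. }
    rewrite Hc. ring.
  - intros z _. auto_derive.
    + exists (curvature' nu z). apply curvature_derive; lra.
    + replace (Derive (fun x : R => curvature nu x) z) with (curvature' nu z)
        by (symmetry; apply is_derive_unique, curvature_derive; lra). ring.
  - intros z Hz.
    assert (HF := hyp0F1_lower nu z ltac:(lra) ltac:(lra)).
    assert (HE := curvature_euler nu z).
    assert (Hq : 0 <= z / (nu + 1)) by (apply Rdiv_le_0_compat; lra).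
    assert (Hsq : 1 + 2 * (z / (nu + 1)) <= hyp0F1 nu z ^ 2) by nra.
    assert (Hb : (/ 2 - 2 * nu ^ 2) * (2 * (z / (nu + 1))) = (1 + 2 * nu) * (b * z))
      by (unfold b; field; lra).
    assert (Hk : 0 <= (/ 2 - 2 * nu ^ 2)) by nra.
    pose proof (Rmult_le_compat_l _ _ _ Hk Hsq). lra.
Qed.

(** For [nu < 1/4] the slope in [curvature_lower] exceeds [2/5], so at [z = 4]
    the linear bound is already above [8/5 - 3/4]. *)
Lemma curvature_pos (nu z : R) : 0 <= nu < / 4 -> 4 < z -> 0 < curvature nu z.
Proof.
  intros Hnu Hz.
  eapply Rlt_le_trans; [| apply curvature_lower; lra].
  assert (H : 2 / 5 <= (1 - 2 * nu) / (nu + 1)) by (apply -> Rle_div_r; lra).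
  assert (Hz0 : 0 <= z) by lra.
  pose proof (Rmult_le_compat_r z _ _ Hz0 H). lra.
Qed.

(** * Derivatives of the logarithm *)

Lemma besselG_eq (nu u : R) :
  0 <= nu -> 0 < u ->
  besselG nu u = (nu + / 2) * ln u + ln (hyp0F1 nu (u ^ 2 / 4))
                 - (nu * ln 2 + ln (Gamma (nu + 1))).
Proof.
  intros Hnu Hu. unfold besselG. rewrite BesselI_eq by easy.
  assert (HG : 0 < Gamma (nu + 1)) by (apply Gamma_pos; lra).
  assert (HF : 0 < hyp0F1 nu (u ^ 2 / 4)) by (apply hyp0F1_pos; nra).
  assert (HR : 0 < Rpower (u / 2) nu) by apply exp_pos.
  assert (Hs : 0 < sqrt u) by now apply sqrt_lt_R0.
  assert (Hls : ln u = ln (sqrt u) + ln (sqrt u)).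
  { rewrite <- ln_mult by easy. now rewrite sqrt_sqrt by lra. }
  rewrite ln_mult, ln_mult, ln_div; try easy.
  - unfold Rpower. rewrite ln_exp, ln_div by lra. lra.
  - now apply Rdiv_lt_0_compat.
  - apply Rmult_lt_0_compat; [now apply Rdiv_lt_0_compat | easy].
Qed.

Lemma locally_pos (u : R) : 0 < u -> locally u (fun v => 0 < v).
Proof. apply (open_gt 0). Qed.

Definition besselG' (nu u : R) : R :=
  (nu + / 2) / u + u / 2 * (hyp0F1' nu (u ^ 2 / 4) / hyp0F1 nu (u ^ 2 / 4)).

Lemma besselG_derive (nu u : R) :
  0 <= nu -> 0 < u -> is_derive (besselG nu) u (besselG' nu u).
Proof.
  intros Hnu Hu.
  eapply is_derive_ext_loc.
  { eapply filter_imp; [| apply (locally_pos u Hu)].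
    intros v Hv. symmetry. now apply besselG_eq. }
  assert (HF : 0 < hyp0F1 nu (u ^ 2 / 4)) by (apply hyp0F1_pos; nra).
  assert (H1 := hyp0F1_derive nu (u ^ 2 / 4) Hnu).
  replace (u ^ 2 / 4) with (u * (u * 1) * / 4) in * by (simpl; field).
  auto_derive.
  - repeat split; try easy. eexists; eassumption.
  - rewrite (is_derive_unique (hyp0F1 nu) _ _ H1 : Derive (fun x : R => hyp0F1 nu x) _ = _).
    unfold besselG'. replace (u ^ 2 / 4) with (u * (u * 1) * / 4) by (simpl; field).
    field. lra.
Qed.

Lemma besselG_derive2 (nu u : R) :
  0 <= nu -> 0 < u ->
  is_derive (besselG' nu) u
    (curvature nu (u ^ 2 / 4) / (u ^ 2 * hyp0F1 nu (u ^ 2 / 4) ^ 2)).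
Proof.
  intros Hnu Hu.
  assert (HF : 0 < hyp0F1 nu (u ^ 2 / 4)) by (apply hyp0F1_pos; nra).
  assert (H1 := hyp0F1_derive nu (u ^ 2 / 4) Hnu).
  assert (H2 := hyp0F1'_derive nu (u ^ 2 / 4) Hnu).
  unfold besselG', curvature.
  assert (Hode := hyp0F1_ode nu (u ^ 2 / 4) Hnu).
  replace (u ^ 2 / 4) with (u * (u * 1) * / 4) in * by (simpl; field).
  auto_derive.
  - repeat split; try lra; eexists; eassumption.
  - rewrite (is_derive_unique (hyp0F1 nu) _ _ H1 : Derive (fun x : R => hyp0F1 nu x) _ = _).
    rewrite (is_derive_unique (hyp0F1' nu) _ _ H2 : Derive (fun x : R => hyp0F1' nu x) _ = _).
    set (f := hyp0F1 nu _) in *. set (f1 := hyp0F1' nu _) in *. set (f2 := hyp0F1'' nu _) in *.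
    replace f2 with ((f - (nu + 1) * f1) * (4 / u ^ 2)).
    + field. lra.
    + rewrite <- Hode. field. lra.
Qed.

Lemma besselG_Derive_n_2 (nu u : R) :
  0 <= nu -> 0 < u ->
  Derive_n (besselG nu) 2 u
  = curvature nu (u ^ 2 / 4) / (u ^ 2 * hyp0F1 nu (u ^ 2 / 4) ^ 2) /\
  twice_derivable_at (besselG nu) u.
Proof.
  intros Hnu Hu.
  assert (H : is_derive (Derive (besselG nu)) u
    (curvature nu (u ^ 2 / 4) / (u ^ 2 * hyp0F1 nu (u ^ 2 / 4) ^ 2))).
  { eapply is_derive_ext_loc; [| now apply besselG_derive2].
    eapply filter_imp; [| apply (locally_pos u Hu)].
    intros v Hv. symmetry. now apply is_derive_unique, besselG_derive. }
  split; [| split].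
  - simpl. now apply is_derive_unique.
  - eapply filter_imp; [| apply (locally_pos u Hu)].
    intros v Hv. exists (besselG' nu v). now apply besselG_derive.
  - eexists; eassumption.
Qed.

Lemma besselG_second_pos (nu u : R) :
  0 <= nu < / 4 -> 4 < u ->
  0 < curvature nu (u ^ 2 / 4) / (u ^ 2 * hyp0F1 nu (u ^ 2 / 4) ^ 2).
Proof.
  intros Hnu Hu. apply Rdiv_lt_0_compat.
  - apply curvature_pos; [easy | nra].
  - apply Rmult_lt_0_compat; apply pow_lt; [lra|]. apply hyp0F1_pos; [easy | nra].
Qed.

(** * Failure of strict log-concavity *)

Lemma log_concavity_fails (nu u : R) :
  0 <= nu < / 4 -> 4 < u -> strict_log_concavity_fails_at nu u.
Proof.
  intros Hnu Hu.
  destruct (besselG_Derive_n_2 nu u) as [H2 Ht]; try lra.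
  split; [easy|]. unfold strict_log_concavity_at. rewrite H2.
  pose proof (besselG_second_pos nu u Hnu Hu). lra.
Qed.

(** Strict concavity at the midpoint 6 of [5, 7] contradicts the monotonicity of
    [g'] there, by the mean value theorem on [5, 6] and on [6, 7]. *)
Lemma not_log_concave (nu : R) :
  0 <= nu < / 4 -> ~ strictly_log_concave_sqrt_Bessel nu.
Proof.
  intros Hnu Hconc.
  assert (H := Hconc 5 7 (/ 2) ltac:(lra) ltac:(lra) ltac:(lra) ltac:(lra)).
  replace (/ 2 * 5 + (1 - / 2) * 7) with 6 in H by field.
  assert (Hmvt : forall a, 4 < a -> exists c, a <= c <= a + 1 /\
    besselG nu (a + 1) - besselG nu a = besselG' nu c).
  { intros a Ha.
    destruct (MVT_gen (besselG nu) a (a + 1) (besselG' nu)) as [c [Hc E]];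
      rewrite ?Rmin_left, ?Rmax_right in * by lra.
    - intros x Hx. apply besselG_derive; lra.
    - intros x Hx. apply derivable_continuous_pt. exists (besselG' nu x).
      apply is_derive_Reals, besselG_derive; lra.
    - exists c. split; [easy|]. rewrite E. ring. }
  destruct (Hmvt 5) as [c [Hc Ec]]; [lra|].
  destruct (Hmvt 6) as [d [Hd Ed]]; [lra|].
  replace (5 + 1) with 6 in * by ring. replace (6 + 1) with 7 in * by ring.
  assert (besselG' nu c <= besselG' nu d); [| lra].
  apply nondecreasing_of_derivative with
    (fun u => curvature nu (u ^ 2 / 4) / (u ^ 2 * hyp0F1 nu (u ^ 2 / 4) ^ 2)); [lra | |].
  - intros x Hx. apply besselG_derive2; lra.
  - intros x Hx. apply Rlt_le, besselG_second_pos; lra.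
Qed.

Theorem mainTheorem5 :
  ~ (forall nu : R, 0 <= nu -> strictly_log_concave_sqrt_Bessel nu) /\
  strict_log_concavity_fails_at 0 10 /\
  (exists U : R * R -> Prop,
     open U /\
     (exists p : R * R, U p) /\
     (forall nu u : R, U (nu, u) ->
        0 < nu /\ 0 < u /\ strict_log_concavity_fails_at nu u)).
Proof.
  split; [| split].
  - intros H. apply (not_log_concave 0); [lra|]. apply H. lra.
  - apply log_concavity_fails; lra.
  - exists (fun p => (0 < fst p /\ fst p < / 4) /\ 4 < snd p).
    split; [| split].
    + apply open_and; [apply open_and|].
      * apply (open_comp fst (fun x => 0 < x)); [| apply open_gt].
        intros [a b] _. apply continuous_fst.
      * apply (open_comp fst (fun x => x < / 4)); [| apply open_lt].
        intros [a b] _. apply continuous_fst.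
      * apply (open_comp snd (fun x => 4 < x)); [| apply open_gt].
        intros [a b] _. apply continuous_snd.
    + exists (/ 8, 5). simpl. lra.
    + simpl. intros nu u [Hnu Hu].
      split; [lra|]. split; [lra|]. apply log_concavity_fails; lra.
Qed.
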